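(* Let $\pi^*_{\mathrm{TMDP}}$ be an optimal policy of the Track-MDP and let $\pi^*_{\mathrm{POMDP}}$ be an optimal policy of the POMDP, for tracking a target with transition matrix $P$. Then $$V^{\pi^*_{\mathrm{TMDP}}}_{\mathrm{TMDP}}\big((b^j,0,\emptyset)\big)=V^{\pi^*_{\mathrm{POMDP}}}_{\mathrm{POMDP}}\big((e_{b^j},0)\big)\qquad\text{for all } j\in\{1,\dots,N^2\}.$$
   Context: Target. Let $N\ge 1$, $\bar{\mathcal X}=\{b^1,\dots,b^{N^2}\}$ (the grid cells) and $\mathcal X=\bar{\mathcal X}\cup\{b^T\}$. The target position $(x_k)_{k\ge 0}$ is a time-homogeneous Markov chain on $\mathcal X$ with transition matrix $P$. The terminal state $b^T$ (target has left the grid) is absorbing and is reached with probability one from every cell, so all expected total rewards below are finite. Actions and observations. $\mathcal A=2^{\bar{\mathcal X}}$; an action $a\in\mathcal A$ is the set of sensors turned on. There is also a special ''safe sensing'' action $\hat a_s\notin\mathcal A$ which always reveals the target's position. If $a_k$ is used at time $k$ and $x_k\neq b^T$, the observation is $y_k=x_k$ if $x_k\in a_k$ or $a_k=\hat a_s$, and $y_k=\mathcal E$ (uninformative) otherwise. Exit ($x_k=b^T$) is always detected. The initial position $x_0$ is known. Reward. With constants $r,c,D>0$, the reward $R(x_k,a_k)$ at time $k\ge1$ is $0$ if $x_k=b^T$; otherwise it is $r\mathbf 1_{\{x_k\in a_k\}}-c|a_k|$ if $a_k\in\mathcal A$, and $r-D$ if $a_k=\hat a_s$. Safe sensing. Fix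 an integer $T_{\max}\ge 0$. Let $l(k)$ be the last time $\le k$ at which the target was observed ($l(0)=0$) and $n(k)=k-l(k)$. Both formulations require $a_{k+1}=\hat a_s$ if $n(k)=T_{\max}+1$, and $a_{k+1}\in\mathcal A$ if $n(k)\le T_{\max}$. Track-MDP. States are triples $(x,n,h)$ with $x\in\bar{\mathcal X}$, $0\le n\le T_{\max}+1$, $h\in\mathcal A^n$, together with an absorbing zero-reward terminal state $s_T$. The state at time $k$ is $s_k=(x_{l(k)},n(k),h_k)$ with $h_k=(a_{l(k)+1},\dots,a_k)$, and $s_k=s_T$ once the target has exited. A policy maps each non-terminal state to an allowed action, $a_{k+1}=\pi(s_k)$. $V^\pi_{\mathrm{TMDP}}(s_0)=\mathbb E[\sum_{k\ge1}R(x_k,a_k)\mid s_0]$. $\pi^*_{\mathrm{TMDP}}$ is a policy maximizing $V^\pi_{\mathrm{TMDP}}(s)$ simultaneously for all states $s=(x,n,h)$ that are feasible, meaning that the chain started at $x$ has positive probability of staying in the grid and avoiding the successive action sets in $h$ during the next $n$ steps. POMDP. The belief at time $k$ is $v_k=(\beta_k,n(k))$, where $\beta_k$ is the conditional distribution of $x_k$ given all past observations (including exit information) and actions; $e_{b^j}$ is the point mass at $b^j$. General policies choose $a_{k+1}$ as a function of all information available at time $k$ (past observations and actions), subject to the safe sensing requirement. $V^\pi_{\mathrm{POMDP}}(v_0)=\mathbb E[\sum_{k\ge1}R(x_k,a_k)\mid v_0]$. $\pi^*_{\mathrm{POMDP}}$ is a stationary policy $a_{k+1}=\pi^*_{\mathrm{POMDP}}(v_k)$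 that maximizes $V^\pi_{\mathrm{POMDP}}(v_0)$ among all such policies, for every initial belief $v_0$ of the form $(e_{b^j},0)$. *)

(* Defs.v *)
From HB Require Import structures.
From mathcomp Require Import all_boot all_order all_algebra.
From mathcomp Require Import all_classical all_reals all_analysis.

Set Implicit Arguments.
Unset Strict Implicit.
Unset Printing Implicit Defensive.

Import Order.TTheory GRing.Theory Num.Theory.
Import numFieldNormedType.Exports.
Local Open Scope classical_set_scope.
Local Open Scope ring_scope.

Definition cell (N : nat) := 'I_(N ^ 2).

(* [None] is the terminal state b^T: the target has left the grid. *)
Definition target (N : nat) := option (cell N).

Variant action (N : nat) := Sense of {set cell N} | SafeSense.
Arguments SafeSense {N}.

(* [Located None] is the detection of the exit. *)
Variant observation (N : nat) := Located of target N | Uninformative.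
Arguments Uninformative {N}.

Definition observe N (a : action N) (y : target N) : observation N :=
  match y, a with
  | None, _ => Located y
  | Some _, SafeSense => Located y
  | Some b, Sense A => if b \in A then Located y else Uninformative
  end.

Definition reward (R : realType) N (r c D : R) (y : target N) (a : action N) : R :=
  match y, a with
  | None, _ => 0
  | Some b, Sense A => r * (b \in A)%:R - c * #|A|%:R
  | Some _, SafeSense => r - D
  end.

(* Almost surely the target exits, so that only finitely many u k are nonzero;
   the value of limn on the remaining null set is immaterial. *)
Definition total_reward (R : realType) (u : nat -> R) : R :=
  limn (fun m => \sum_(1 <= k < m) u k).

Definition allowed N (Tmax n : nat) (a : action N) : Prop :=
  (n = Tmax.+1 -> a = SafeSense) /\
  ((n <= Tmax)%N -> exists A, a = Sense A).

Definition transition_matrix (R : realType) (T : finType) (P : T -> T -> R) :=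
  (forall x y, 0 <= P x y) /\ (forall x, \sum_y P x y = 1).

Section Tracking.
Context (R : realType) (N Tmax : nat) (r c D : R).
Context (d : measure_display) (Omega : measurableType d).
(* The target's trajectory does not depend on the actions, so one process X
   serves all policies; [Pr b] is the law under which it starts at b. *)
Context (Pr : cell N -> probability Omega R) (X : nat -> Omega -> target N).

Definition markov_chain (P : target N -> target N -> R) : Prop :=
  [/\ forall k y, measurable [set w | X k w = y],
      forall b, Pr b [set w | X 0%N w = Some b] = 1%E
    & forall b k (p : nat -> target N),
        Pr b [set w | forall i, (i <= k.+1)%N -> X i w = p i] =
        (Pr b [set w | forall i, (i <= k)%N -> X i w = p i] *
         (P (p k) (p k.+1))%:E)%E].

(* Track-MDP *)

Definition track_state := (cell N * nat * seq {set cell N})%type.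

Definition valid_track_state (s : track_state) : Prop :=
  let: (_, n, h) := s in (n <= Tmax.+1)%N /\ size h = n.

(* With the clock started at the last observation, at x = [s.1.1]: during the
   next n steps the target stays in the grid and avoids the sets in h. *)
Definition unseen (s : track_state) : set Omega :=
  let: (_, n, h) := s in
  [set w | forall i, (i < n)%N ->
     exists2 b, X i.+1 w = Some b & b \notin nth finset.set0 h i].

Definition feasible (s : track_state) : Prop :=
  valid_track_state s /\ (0 < Pr s.1.1 (unseen s))%E.

Definition track_policy (pi : track_state -> action N) : Prop :=
  forall s, valid_track_state s -> allowed Tmax s.1.2 (pi s).

(* [None] is the absorbing terminal state s_T. *)
Definition track_step (s : track_state) (a : action N) (y : target N) :
    option track_state :=
  let: (x, n, h) := s in
  match y, a with
  | None, _ => None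
  | Some b, SafeSense => Some (b, 0%N, [::])
  | Some b, Sense A =>
      Some (if b \in A then (b, 0%N, [::]) else (x, n.+1, rcons h A))
  end.

(* State after k steps from s, where p i is the target's position i steps
   after the instant at which the state is s. *)
Fixpoint track_run (pi : track_state -> action N) (s : track_state)
    (p : nat -> target N) (k : nat) : option track_state :=
  if k is k'.+1 then
    if track_run pi s p k' is Some s' then track_step s' (pi s') (p k) else None
  else Some s.

Definition track_reward (pi : track_state -> action N) (s : track_state)
    (p : nat -> target N) (k : nat) : R :=
  if track_run pi s p k.-1 is Some s' then reward r c D (p k) (pi s') else 0.

(* Expected total reward given s_0 = (x, n, h). By time homogeneity the clock
   is started at the last observation, so that s is the state at instant n, and
   the conditioning on s is the conditioning of the chain started at x on
   [unseen s]. This is meaningful for feasible s only. *)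
Definition track_value (pi : track_state -> action N) (s : track_state) : \bar R :=
  (((fine (Pr s.1.1 (unseen s)))^-1)%:E *
   \int[Pr s.1.1]_(w in unseen s)
     (total_reward (track_reward pi s (fun i => X (s.1.2 + i)%N w)))%:E)%E.

Definition track_optimal (pi : track_state -> action N) : Prop :=
  track_policy pi /\
  forall pi', track_policy pi' ->
    forall s, feasible s -> (track_value pi' s <= track_value pi s)%E.

(* POMDP *)

(* The initial position and the past pairs (a_i, y_i), in chronological order. *)
Definition info := (cell N * seq (action N * observation N))%type.

(* n(k) = k - l(k). The detection of the exit counts as an observation of the
   target; the convention after the exit affects no reward. *)
Definition age (I : info) : nat :=
  foldl (fun n (ay : action N * observation N) =>
           if ay.2 is Located _ then 0%N else n.+1) 0%N I.2.

Definition info_event (I : info) : set Omega :=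
  [set w | forall i, (i < size I.2)%N ->
     let: (a, y) := nth (SafeSense, Uninformative) I.2 i in
     observe a (X i.+1 w) = y].

(* The conditional law of the current position. Actions are determined by the
   past information and do not influence the chain, so conditioning on them
   amounts to using their values in [info_event]. *)
Definition belief (I : info) : {ffun target N -> R} :=
  [ffun y => fine (Pr I.1 (info_event I `&` [set w | X (size I.2) w = y])) /
             fine (Pr I.1 (info_event I))].

Definition general_policy (pi : info -> action N) : Prop :=
  forall I, allowed Tmax (age I) (pi I).

Fixpoint info_run (pi : info -> action N) (b : cell N) (p : nat -> target N)
    (k : nat) : info :=
  if k is k'.+1 then
    let I := info_run pi b p k' in
    (I.1, rcons I.2 (pi I, observe (pi I) (p k)))
  else (b, [::]).

(* The expected total reward for the initial belief (e_b, 0). *)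
Definition pomdp_value (pi : info -> action N) (b : cell N) : \bar R :=
  ('E_(Pr b)[fun w => total_reward (fun k =>
     reward r c D (X k w) (pi (info_run pi b (X^~ w) k.-1)))])%E.

Definition belief_policy (sigma : {ffun target N -> R} * nat -> action N) : Prop :=
  forall v, allowed Tmax v.2 (sigma v).

Definition of_belief (sigma : {ffun target N -> R} * nat -> action N) :
    info -> action N :=
  fun I => sigma (belief I, age I).

Definition pomdp_optimal (sigma : {ffun target N -> R} * nat -> action N) : Prop :=
  belief_policy sigma /\
  forall pi', general_policy pi' ->
    forall b, (pomdp_value pi' b <= pomdp_value (of_belief sigma) b)%E.

Lemma initial_belief P (b : cell N) : markov_chain P ->
  belief (b, [::]) = [ffun y => (y == Some b)%:R].
Proof.
case=> mX X0 _; apply/ffunP => y; rewrite !ffunE /=.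
have -> : info_event (b, [::]) = setT by apply/seteqP; split.
rewrite setTI probability_setT /= divr1.
have [->|yb] := eqVneq y (Some b); first by rewrite X0.
suff -> : Pr b [set w | X 0%N w = y] = 0%E by [].
apply/eqP; rewrite eq_le measure_ge0 andbT.
have <- : Pr b (~` [set w | X 0%N w = Some b]) = 0%E.
  by rewrite probability_setC ?X0 ?subee//; exact: mX.
apply: le_measure; rewrite ?inE; [exact: mX|exact/measurableC/mX|].
by move=> w /= -> /eqP; exact/negP.
Qed.

End Tracking.

(* Main.v *)
(** Along the almost sure trajectories whose finite prefixes all have positive
    probability, the Track-MDP state is a function [compress] of the POMDP
    information, so a Track-MDP policy composed with [compress] is a general
    POMDP policy collecting the same rewards. Conversely, the filter forgets
    everything before the last observation of the target: the belief depends
    on the information only through [compress], so an optimal belief policy is,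
    with the same rewards, a Track-MDP policy. Optimality of the two given
    policies turns this into two inequalities between the values. *)

Require Import Defs.
From HB Require Import structures.
From mathcomp Require Import all_boot all_order all_algebra.
From mathcomp Require Import all_classical all_reals all_analysis.
From mathcomp Require Import measurable_realfun.

Import Order.TTheory GRing.Theory Num.Theory.
Local Open Scope classical_set_scope.
Local Open Scope ring_scope.

Set Implicit Arguments.
Unset Strict Implicit.
Unset Printing Implicit Defensive.

(** * Integration and measure preliminaries *)

Import HBNNSimple.

(* Unlike [ae_eq_integral], this covers integrands like [total_reward], which
   is a junk [limn] off the convergence set. *)
Lemma eq_integral_off_null (d : measure_display) (T : measurableType d)
    (R : realType) (mu : {measure set T -> \bar R}) (Z : set T)
    (f g : T -> \bar R) :
  measurable Z -> mu Z = 0%E -> (forall x, ~ Z x -> f x = g x) ->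
  (\int[mu]_x f x = \int[mu]_x g x)%E.
Proof.
move=> mZ Z0 fg.
pose nnint (u : T -> \bar R) := ereal_sup [set sintegral mu h |
  h in [set h : {nnsfun T >-> R} | forall x, ((h x)%:E <= u x)%E]].
have le_nnint u v : (forall x, 0 <= v x)%E -> (forall x, ~ Z x -> u x = v x) ->
    (nnint u <= nnint v)%E.
  move=> v0 uv; apply/ge_ereal_sup => _ [h /= hu <-].
  (* Cutting [h] to zero on [Z] keeps it below [v], which is nonnegative there, and leaves its
     integral unchanged. *)
  apply: ereal_sup_ubound; exists (proj_nnsfun h (measurableC mZ)) => /=.
    move=> x; rewrite mindicE; have [Zx|Zx] := pselect (Z x).
      by rewrite memNset ?mulr0 //; apply.
    by rewrite mem_set // mulr1 -uv.
  rewrite -!integralT_nnsfun; apply: ge0_ae_eq_integral => //.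
  - exact/measurable_EFinP.
  - exact/measurable_EFinP.
  - by move=> x _; rewrite lee_fin.
  - by move=> x _; rewrite lee_fin.
  - exists Z; split => // x /= /not_implyP[_]; apply: contra_notP => Zx.
    by rewrite mindicE mem_set // mulr1.
have eq_nnint u v : (forall x, 0 <= u x)%E -> (forall x, 0 <= v x)%E ->
    (forall x, ~ Z x -> u x = v x) -> nnint u = nnint v.
  move=> u0 v0 uv; apply/eqP; rewrite eq_le !le_nnint // => x Zx.
  by rewrite uv.
rewrite /integral !patch_setT; congr (_ - _)%E; apply: eq_nnint => // x Zx.
- by rewrite !funeposE fg.
- by rewrite !funenegE fg.
Qed.

Lemma measure_partition (d : measure_display) (Omega : measurableType d)
    (R : realType) (mu : {measure set Omega -> \bar R}) (T : finType)
    (Y : Omega -> T) (A : set Omega) :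
  (forall t, measurable (A `&` [set w | Y w = t])) ->
  mu A = (\sum_(t : T) mu (A `&` [set w | Y w = t]))%E.
Proof.
move=> mA; have AE : A = \bigcup_(t in [set: T]) (A `&` [set w | Y w = t]).
  by apply/seteqP; split => [w Aw|w [t _ []//]]; exists (Y w).
rewrite {1}AE measure_fin_bigcup //; last 2 first.
- exact: finite_finset.
- by move=> s t _ _ [w [[_ /= <-] [_ /= <-]]].
rewrite [RHS]fsbig_seq ?index_enum_uniq //.
by apply: eq_fsbigl; apply/seteqP; split => t //= _; rewrite mem_index_enum.
Qed.

(** * Events decided by a finite prefix of the trajectory *)

Section Chain.
Context (R : realType) (N : nat).
Context (d : measure_display) (Omega : measurableType d).
Context (Pr : cell N -> probability Omega R) (X : nat -> Omega -> target N).
Context (P : target N -> target N -> R).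
Context (MC : markov_chain Pr X P).

Let mX k y : measurable [set w | X k w = y]. Proof. by case: MC. Qed.

Definition cylinder (k : nat) (p : nat -> target N) : set Omega :=
  [set w | forall i, (i <= k)%N -> X i w = p i].

(** Membership in the sigma-algebra generated by [X 0], ..., [X k], phrased as invariance since
    there are only finitely many prefixes. *)
Definition depends_upto (k : nat) (A : set Omega) : Prop :=
  forall w w', (forall i, (i <= k)%N -> X i w = X i w') -> A w -> A w'.

Definition path_upto (k : nat) (w : Omega) : {ffun 'I_k.+1 -> target N} :=
  [ffun i => X (val i) w].

Lemma path_uptoP k w w' :
  path_upto k w = path_upto k w' <-> forall i, (i <= k)%N -> X i w = X i w'.
Proof.
split=> [/ffunP e i ik|e]; last first.
  by apply/ffunP => i; rewrite !ffunE e // -ltnS ltn_ord.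
by have := e (Ordinal (ik : (i < k.+1)%N)); rewrite !ffunE.
Qed.

Lemma cylinderE k w : cylinder k (X^~ w) =
  [set w' | path_upto k w' = path_upto k w].
Proof. by apply/seteqP; split => w' /= h; apply/path_uptoP. Qed.

Lemma measurable_cylinder k p : measurable (cylinder k p).
Proof.
have -> : cylinder k p = \bigcap_(i in `I_k.+1) [set w | X i w = p i].
  by apply/seteqP; split => w h i; apply: h.
by apply: bigcap_measurableType => i _; exact: mX.
Qed.

(** Fibres of [path_upto k] are the atoms: an invariant event that meets one contains it. Events
    thus reduce to cylinders, where the product formula of [markov_chain] applies. *)
Lemma depends_upto_atom k (A : set Omega) t : depends_upto k A ->
  A `&` [set w | path_upto k w = t] = set0 \/
  exists2 w, A w & A `&` [set w | path_upto k w = t] = cylinder k (X^~ w).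
Proof.
move=> dA; set B := A `&` _.
have [|/set0P[w [Aw Bw]]] := eqVneq B set0; [by left|rewrite /B -Bw].
right; exists w => //; rewrite -cylinderE setIidr // => w' cw'.
by apply: dA Aw => i ik; rewrite cw'.
Qed.

Lemma measurable_depends_upto k A : depends_upto k A -> measurable A.
Proof.
move=> dA; have -> : A = \bigcup_(t in [set: {ffun 'I_k.+1 -> target N}])
    (A `&` [set w | path_upto k w = t]).
  by apply/seteqP; split => [w Aw|w [t _ []//]]; exists (path_upto k w).
apply: fin_bigcup_measurable => [|t _]; first exact: finite_finset.
have [->//|[w _ ->]] := depends_upto_atom t dA.
exact: measurable_cylinder.
Qed.

Lemma depends_uptoI k A B :
  depends_upto k A -> depends_upto k B -> depends_upto k (A `&` B).
Proof. by move=> dA dB w w' e [Aw Bw]; split; [exact: dA Aw|exact: dB Bw]. Qed.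

Lemma depends_uptoS k A : depends_upto k A -> depends_upto k.+1 A.
Proof. by move=> dA w w' e; apply: dA => i ik; apply: e; exact: leqW. Qed.

Arguments depends_uptoI {k A B}.
Arguments depends_uptoS {k A}.

Lemma depends_upto_at k y : depends_upto k [set w | X k w = y].
Proof. by move=> w w' e /= <-; rewrite e. Qed.

Lemma depends_upto_path k t : depends_upto k [set w | path_upto k w = t].
Proof. by move=> w w' e /= <-; apply/path_uptoP => i /e. Qed.

Arguments depends_upto_at : clear implicits.
Arguments depends_upto_path : clear implicits.

Lemma measure_cylinderS b k p : Pr b (cylinder k.+1 p) =
  (Pr b (cylinder k p) * (P (p k) (p k.+1))%:E)%E.
Proof. by case: MC => _ _; exact. Qed.

(** The product formula for single paths is summed over the atoms of [A] whose path ends in [z]. *)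
Lemma markov_step b k A z y : depends_upto k A ->
  Pr b (A `&` [set w | X k w = z] `&` [set w | X k.+1 w = y]) =
  (Pr b (A `&` [set w | X k w = z]) * (P z y)%:E)%E.
Proof.
move=> dA; set B := A `&` _.
have dB : depends_upto k B by exact (depends_uptoI dA (depends_upto_at k z)).
have mt C t : depends_upto k.+1 C ->
    measurable (C `&` [set w | path_upto k w = t]).
  move=> dC; apply: (@measurable_depends_upto k.+1).
  exact (depends_uptoI dC (depends_uptoS (depends_upto_path k t))).
rewrite (@measure_partition _ _ _ _ _ (path_upto k)) => [|t]; last first.
  exact (mt _ t (depends_uptoI (depends_uptoS dB) (depends_upto_at k.+1 y))).
rewrite [in RHS](@measure_partition _ _ _ _ _ (path_upto k)) => [|t];
  last first.
  exact (mt _ t (depends_uptoS dB)).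
rewrite ge0_sume_distrl => [|t _]; last exact: measure_ge0.
apply: eq_bigr => t _; rewrite setIAC.
have [->|[w [Aw Xw] ->]] := depends_upto_atom t dB.
  by rewrite set0I measure0 mul0e.
(* The prefix of [w] prolonged by [y], so that the event one step later is again a cylinder. *)
pose p i := if (i <= k)%N then X i w else y.
have -> : cylinder k (X^~ w) = cylinder k p.
  by apply/seteqP; split => w' e i ik; rewrite e // /p ik.
have -> : cylinder k p `&` [set w0 | X k.+1 w0 = y] = cylinder k.+1 p.
  apply/seteqP; split => [w' [e e'] i|w' e].
    rewrite leq_eqVlt ltnS => /orP[/eqP ->|/e//].
    by rewrite e' /p ltnn.
  by split => [i ik|/=]; rewrite e // ?leqW // /p ltnn.
by rewrite [LHS]measure_cylinderS /p leqnn ltnn Xw.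
Qed.

(** Each horizon has finitely many null prefixes, and there are countably many horizons. *)
Lemma ae_cylinder_neq0 b :
  exists Z : set Omega, [/\ measurable Z, Pr b Z = 0%E &
    forall w, ~ Z w -> forall k, Pr b (cylinder k (X^~ w)) <> 0%E].
Proof.
pose Zk k := [set w | Pr b (cylinder k (X^~ w)) = 0%E].
have dZ k : depends_upto k (Zk k).
  move=> w w' e; rewrite /Zk /= => <-; congr (Pr b _).
  by apply/seteqP; split => v h i ik; rewrite h // e.
have mZ k : measurable (Zk k) by exact: measurable_depends_upto (dZ k).
exists (\bigcup_k Zk k); split.
- exact: bigcup_measurable.
- have : (Pr b).-negligible (\bigcup_k Zk k).
    apply: negligible_bigcup => k; apply/negligibleP => //.
    rewrite [LHS](@measure_partition _ _ _ _ _ (path_upto k)) => [|t];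
      last first.
      exact (measurable_depends_upto
        (depends_uptoI (dZ k) (depends_upto_path k t))).
    apply: big1 => t _.
    by have [->|[w Zw ->]] := depends_upto_atom t (dZ k); rewrite ?measure0.
  by move/negligibleP; apply; exact: bigcup_measurable.
- by move=> w Zw k Zk0; apply: Zw; exists k.
Qed.


Context (Pstoch : transition_matrix P).

Lemma exit_absorbing : P None None = 1 -> forall y, P None y <> 0 -> y = None.
Proof.
move=> P1 [y|//] Py; case: Pstoch => P0 Psum.
have := Psum None; rewrite (bigD1 None) //= (bigD1 (Some y)) //= P1 => /eqP.
rewrite addrC -subr_eq0 addrK => /eqP e; case: Py; apply/eqP.
rewrite eq_le P0 andbT -e lerDl; exact: sumr_ge0.
Qed.

(** * The filter and its dependence on the Track-MDP state *)

Lemma depends_upto_info_event (I : info N) :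
  depends_upto (size I.2) (info_event X I).
Proof.
move=> w w' e h i ii; have := h i ii.
by case: nth => a o; rewrite e.
Qed.

(** The unnormalised filter: its recursion is linear, and no division by a null probability
    intervenes. *)
Definition weight (I : info N) (y : target N) : R :=
  fine (Pr I.1 (info_event X I `&` [set w | X (size I.2) w = y])).

Let measurable_weight (I : info N) y :
  measurable (info_event X I `&` [set w | X (size I.2) w = y]).
Proof.
exact (measurable_depends_upto
  (depends_uptoI (@depends_upto_info_event I) (depends_upto_at (size I.2) y))).
Qed.

Lemma sum_weight (I : info N) :
  \sum_y weight I y = fine (Pr I.1 (info_event X I)).
Proof.
rewrite [in RHS](@measure_partition _ _ _ _ _ (X (size I.2))) => [|y];
  last first.
  exact: measurable_weight.
rewrite -sum_fine // => y _; exact: fin_num_measure.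
Qed.

Lemma beliefE (I : info N) :
  belief Pr X I = [ffun y => weight I y / \sum_z weight I z].
Proof. by apply/ffunP => y; rewrite !ffunE sum_weight. Qed.

Lemma weight_nil b y : weight (b, [::]) y = (y == Some b)%:R.
Proof.
have := initial_belief b MC => /ffunP/(_ y); rewrite !ffunE /= => <-.
have -> : info_event X (b, [::]) = setT by apply/seteqP; split.
by rewrite /weight probability_setT divr1 /=; congr (fine (Pr b (_ `&` _)));
  apply/seteqP; split.
Qed.

Lemma info_event_rcons b s a o : info_event X (b, rcons s (a, o)) =
  info_event X (b, s) `&` [set w | observe a (X (size s).+1 w) = o].
Proof.
apply/seteqP; split => w.
  move=> h; split => [i /= ii|/=].
    by have := h i; rewrite /= size_rcons nth_rcons ii; apply; exact: leqW.
  by have := h (size s); rewrite /= size_rcons nth_rcons ltnn eqxx; apply.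
case=> h ao i /=; rewrite size_rcons nth_rcons ltnS leq_eqVlt.
by case/orP => [/eqP ->|ii]; rewrite ?ltnn ?eqxx ?ii //; exact: h.
Qed.

(* The filter recursion for the unnormalised belief is linear, so an observation
   of the target, which reduces the weight to a multiple of a point mass, erases
   the past up to a factor. *)
Lemma weight_rcons b s a o y : weight (b, rcons s (a, o)) y =
  `[< observe a y = o >]%:R * \sum_z weight (b, s) z * P z y.
Proof.
have E : info_event X (b, rcons s (a, o)) `&` [set w | X (size s).+1 w = y] =
    info_event X (b, s) `&` [set w | X (size s).+1 w = y] `&`
    [set w | observe a y = o].
  by rewrite info_event_rcons; apply/seteqP; split => w /= [[? h] e]; subst y.
rewrite /weight /= size_rcons E; case: asboolP => ao; last first.
  rewrite mul0r [X in Pr b X](_ : _ = set0) ?measure0 //.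
  by apply/seteqP; split => // w [].
rewrite mul1r [X in fine (Pr b X)]setIidl => [|w //].
have dI : depends_upto (size s) (info_event X (b, s)).
  exact: (@depends_upto_info_event (b, s)).
have mI z : measurable (info_event X (b, s) `&`
    [set w | X (size s).+1 w = y] `&` [set w | X (size s) w = z]).
  have dz := depends_uptoI dI (depends_upto_at (size s) z).
  rewrite setIAC; exact (measurable_depends_upto
    (depends_uptoI (depends_uptoS dz) (depends_upto_at (size s).+1 y))).
(* Split over the position one step earlier, so that [markov_step] applies to each slice. *)
rewrite (@measure_partition _ _ _ _ _ (X (size s))) //.
rewrite -sum_fine => [|z _]; last exact: fin_num_measure.
apply: eq_bigr => z _.
rewrite setIAC [X in fine X](markov_step b z y dI) fineM //.
exact/fin_num_measure/(measurable_weight (b, s)).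
Qed.

(* [SafeSense] with [Uninformative] never occurs; its clause only keeps the size
   of the history equal to the age. *)
Definition forget (s : track_state N) (ao : action N * observation N) :
    track_state N :=
  match ao with
  | (_, Located (Some b)) => (b, 0%N, [::])
  | (_, Located None) => (s.1.1, 0%N, [::])
  | (Sense A, Uninformative) => (s.1.1, s.1.2.+1, rcons s.2 A)
  | (SafeSense, Uninformative) => (s.1.1, s.1.2.+1, rcons s.2 finset.set0)
  end.

Definition compress (I : info N) : track_state N :=
  foldl forget (I.1, 0%N, [::]) I.2.

(** A right inverse of [compress] on states whose age is the length of their history: the clock
    restarts at the last observation. *)
Definition unseen_info (s : track_state N) : info N :=
  (s.1.1, [seq (Sense A, Uninformative) | A <- s.2]).

(** After a detected exit [forget] keeps a stale cell, so [compress] determines the belief only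
    before that. *)
Definition no_exit (I : info N) : bool :=
  all (fun ao => if ao.2 is Located None then false else true) I.2.

Lemma compress_rcons b s ao :
  compress (b, rcons s ao) = forget (compress (b, s)) ao.
Proof. by rewrite /compress /= foldl_rcons. Qed.

Lemma age_compress I : age I = (compress I).1.2.
Proof.
case: I => b s; elim/last_ind: s => // s ao IH; rewrite compress_rcons.
rewrite -[LHS]/(foldl _ _ _) foldl_rcons -/(age (b, s)) IH.
by case: ao => [[A|] [[y|]|]].
Qed.

Lemma size_compress I : size (compress I).2 = (compress I).1.2.
Proof.
case: I => b s; elim/last_ind: s => // s ao IH; rewrite compress_rcons.
by case: ao => [[A|] [[y|]|]] //=; rewrite size_rcons IH.
Qed.

(** A sighting makes both sides multiples of a point mass; an uninformative [Sense] applies the same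
    linear map to both and keeps [C]. [C] may be zero. *)
Lemma weight_compress I : no_exit I ->
  exists C, forall y, weight I y = C * weight (unseen_info (compress I)) y.
Proof.
case: I => b s; elim/last_ind: s => [_|s [a o] IH].
  by exists 1 => y; rewrite mul1r.
rewrite /no_exit /= all_rcons => /andP[no /IH[C CE]].
rewrite compress_rcons; case: o no => [[x|//]|] _.
  exists (weight (b, rcons s (a, Located (Some x))) (Some x)) => y.
  have -> : forget (compress (b, s)) (a, Located (Some x)) = (x, 0%N, [::]).
    by case: (a).
  rewrite weight_nil; have [->|yx] := eqVneq y (Some x); first by rewrite mulr1.
  rewrite mulr0 weight_rcons asboolF ?mul0r // => e; case/eqP: yx.
  by move: e; case: (a) y => [A|] [y|] //=; [case: ifP => // _|]; case=> ->.
case: a => [A|].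
  exists C => y; rewrite /unseen_info /= map_rcons !weight_rcons mulrCA.
  congr (_ * _); rewrite mulr_sumr; apply: eq_bigr => z _.
  by rewrite CE mulrA.
(* Safe sensing never yields [Uninformative], so this information has weight zero. *)
exists 0 => y; rewrite mul0r weight_rcons asboolF ?mul0r //.
by case: y.
Qed.

(** Positive probability of the information forces [C] to be nonzero, and normalisation cancels
    it. *)
Lemma belief_compress I : no_exit I -> Pr I.1 (info_event X I) <> 0%E ->
  belief Pr X I = belief Pr X (unseen_info (compress I)).
Proof.
move=> /weight_compress[C CE] I0; rewrite !beliefE; apply/ffunP => y.
rewrite !ffunE.
have sE : \sum_z weight I z = C * \sum_z weight (unseen_info (compress I)) z.
  by rewrite mulr_sumr; apply: eq_bigr.
have : \sum_z weight I z != 0.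
  rewrite sum_weight; apply/eqP => e; apply: I0; rewrite -[LHS]fineK ?e //.
  exact/fin_num_measure/measurable_depends_upto/depends_upto_info_event.
rewrite sE mulf_eq0 negb_or => /andP[C0 _].
by rewrite CE -mulf_div divff // mul1r.
Qed.

(** * Runs of the two models along the same trajectory *)

Lemma info_run1 pi (b : cell N) p k : (info_run pi b p k).1 = b.
Proof. by elim: k. Qed.

Lemma size_info_run pi (b : cell N) p k : size (info_run pi b p k).2 = k.
Proof. by elim: k => //= k IH; rewrite size_rcons IH. Qed.

Lemma cylinder_info_run pi b p k :
  cylinder k p `<=` info_event X (info_run pi b p k).
Proof.
elim: k => [|k IH] w cw //=; rewrite info_event_rcons; split.
  by rewrite -surjective_pairing; apply: IH => i ik; exact/cw/leqW.
by rewrite /= size_info_run cw.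
Qed.

Lemma no_exit_info_run pi (b : cell N) p k :
  (forall i, (i <= k)%N -> p i <> None) -> no_exit (info_run pi b p k).
Proof.
elim: k => [//|k IH] pk; rewrite /no_exit /= all_rcons -/(no_exit _).
rewrite IH => [|i ik]; last exact/pk/leqW.
rewrite andbT /=; have := pk _ (leqnn k.+1).
by case: (p k.+1) => // x _; case: (pi _) => [A|//] /=; case: ifP.
Qed.

(** While the target stays in the grid, [forget] acts as [track_step]; the policies need to agree
    only at the information actually visited. *)
Lemma track_run_compress pi piT (b : cell N) p k :
  (forall i, (i <= k)%N -> p i <> None) ->
  (forall i, (i < k)%N ->
     pi (info_run pi b p i) = piT (compress (info_run pi b p i))) ->
  track_run piT (b, 0%N, [::]) p k = Some (compress (info_run pi b p k)).
Proof.
elim: k => [//|k IH] pk ppi /=.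
rewrite IH; [|by move=> i ik; exact/pk/leqW|by move=> i ik; exact/ppi/leqW].
rewrite compress_rcons -surjective_pairing -ppi //.
have := pk _ (leqnn k.+1); case: (p k.+1) => // x _.
case: (compress _) => -[y n] h; case: (pi _) => [A|//] /=.
by case: ifP.
Qed.

Lemma eq_total_reward (u v : nat -> R) :
  (forall k, u k.+1 = v k.+1) -> total_reward u = total_reward v.
Proof.
move=> uv; rewrite /total_reward.
rewrite (_ : (fun m => _) = fun m => \sum_(1 <= k < m) v k) //.
by apply/funext => m; apply: eq_big_nat => -[//|k] _; exact: uv.
Qed.

Lemma unseen_fresh (b : cell N) : unseen X (b, 0%N, [::]) = setT.
Proof. by apply/seteqP; split. Qed.

(** Serves both inequalities: the rewards coincide off a null set, by agreement of the policies
    before the exit and because both vanish after it. *)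
Lemma track_value_pomdp_value r c D pi piT (b : cell N) : P None None = 1 ->
  (forall p k, Pr b (cylinder k p) <> 0%E ->
     (forall i, (i <= k)%N -> p i <> None) ->
     pi (info_run pi b p k) = piT (compress (info_run pi b p k))) ->
  track_value r c D Pr X piT (b, 0%N, [::]) = pomdp_value r c D Pr X pi b.
Proof.
move=> P1 ppi; rewrite /track_value /pomdp_value unlock.
rewrite unseen_fresh probability_setT /= invr1 mul1e.
have [Z [mZ Z0 ZX]] := ae_cylinder_neq0 b.
apply: (eq_integral_off_null mZ Z0) => w /ZX {}ZX; congr EFin.
(* Leaving the exit has transition probability zero and would make a prefix of [w] null. *)
have X_exit i : X i w = None -> X i.+1 w = None.
  move=> Xi; apply: (exit_absorbing P1); rewrite -Xi => Pi0.
  by apply: (ZX i.+1); rewrite measure_cylinderS Pi0 mule0.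
have X_in k i : (i <= k)%N -> X k w <> None -> X i w <> None.
  move=> /subnK <- + Xi; apply; elim: (k - i)%N => // m IH.
  by rewrite addSn; exact: X_exit.
(* Rewards are summed from index 1, so the predecessor in both reward streams is a genuine one. *)
apply: eq_total_reward => k; rewrite /track_reward /=.
have -> : (fun i => X (0 + i)%N w) = X^~ w by [].
have [Xk|/eqP Xk] := eqVneq (X k.+1 w) None.
  by rewrite add0n Xk; case: track_run.
have ppi' i : (i <= k)%N ->
    pi (info_run pi b (X^~ w) i) = piT (compress (info_run pi b (X^~ w) i)).
  move=> ik; apply: ppi => // i' i'i; apply: (X_in k.+1) => //.
  exact/(leq_trans i'i)/leqW.
rewrite (@track_run_compress pi piT b (X^~ w) k).
- by rewrite add0n ppi'.
- by move=> i ik; apply: (X_in k.+1) => //; exact: leqW.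
- by move=> i ik; exact/ppi'/ltnW.
Qed.

End Chain.

Unset Implicit Arguments.
Set Strict Implicit.
Set Printing Implicit Defensive.

Theorem theorem4 (R : realType) (N Tmax : nat) (r c D : R)
    (P : target N -> target N -> R)
    (d : measure_display) (Omega : measurableType d)
    (Pr : cell N -> probability Omega R) (X : nat -> Omega -> target N)
    (piT : track_state N -> action N)
    (piP : {ffun target N -> R} * nat -> action N) :
  (0 < N)%N ->
  0 < r -> 0 < c -> 0 < D ->
  transition_matrix P ->
  P None None = 1 ->
  markov_chain Pr X P ->
  (forall b : cell N, Pr b [set w | exists k, X k w = None] = 1%E) ->
  track_optimal Tmax r c D Pr X piT ->
  pomdp_optimal Tmax r c D Pr X piP ->
  forall j : cell N,
    track_value r c D Pr X piT (j, 0%N, [::]) =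
    pomdp_value r c D Pr X (of_belief Pr X piP) j.
Proof.
move=> _ _ _ _ Pstoch P1 MC _ [pTpol pTopt] [pPpol pPopt] j.
have fj : feasible Tmax Pr X (j, 0%N, [::]).
  by split; [split | rewrite unseen_fresh probability_setT lte01].
apply/eqP; rewrite eq_le; apply/andP; split.
  rewrite (track_value_pomdp_value MC Pstoch _ _ _
    (pi := piT \o @compress N)) //.
  apply: pPopt => I; rewrite age_compress /=.
  (* [track_policy] constrains valid states only; at ages beyond [Tmax.+1], [allowed] holds
     vacuously. *)
  have [nT|Tn] := leqP (compress I).1.2 Tmax.+1.
    apply: pTpol; move: nT (size_compress I).
    by case: (compress I) => -[].
  by split=> [n_eq|/leqW]; [rewrite n_eq ltnn in Tn|rewrite leqNgt Tn].
(* The Track-MDP policy for the converse inequality plays [piP] at the belief of the information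
   rebuilt from the state. *)
pose piT' s := piP (belief Pr X (unseen_info s), s.1.2).
rewrite -(@track_value_pomdp_value _ _ _ _ _ _ _ MC Pstoch _ _ _ _ piT') //.
  by apply: pTopt => // s _; exact: (pPpol (_, _)).
move=> p k cp pk; rewrite /of_belief /piT' -age_compress; congr (piP (_, _)).
apply: (belief_compress MC); first exact: no_exit_info_run.
(* The information event contains the cylinder of [p], so it cannot be null when the cylinder is
   not. *)
rewrite info_run1 => I0; apply: cp; apply/eqP.
rewrite eq_le measure_ge0 andbT -I0.
apply: le_measure; rewrite ?inE; last exact: cylinder_info_run.
  exact: (measurable_cylinder MC).
exact: (measurable_depends_upto MC (@depends_upto_info_event _ _ _ _ _)).
Qed.
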